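(* Let $d\ge2$. On $\mathbb{S}^{d-1}$ the Laplace--Beltrami operator $\Delta_0$ satisfies the decomposition $$\Delta_0=\sum_{1\le i<j\le d}D_{i,j}^2,$$ that is, $\Delta_0f(\xi)=\sum_{1\le i<j\le d}D_{i,j}^2f(\xi)$ for all $f\in C^2(\mathbb{S}^{d-1})$ and $\xi\in\mathbb{S}^{d-1}$.
   Context: $\mathbb{S}^{d-1}$ is the unit sphere in $\mathbb{R}^d$. For $f\in C^2(\mathbb{S}^{d-1})$ let $F(y)=f(y/\|y\|)$, $y\in\mathbb{R}^d\setminus\{0\}$; the Laplace--Beltrami operator is given by $\Delta_0f(x)=\Delta F(x)$, $x\in\mathbb{S}^{d-1}$, where $\Delta=\sum_{i=1}^d\partial_i^2$. The angular derivatives are $D_{i,j}=x_i\partial_j-x_j\partial_i$, $1\le i\ne j\le d$; they act on functions on the sphere by applying $x_i\partial_j-x_j\partial_i$ to $F$ (or to any smooth extension; the result does not depend on the extension) and restricting to $\mathbb{S}^{d-1}$. *)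

(* Defs.v *)
From HB Require Import structures.
From mathcomp Require Import all_boot all_order all_algebra.
From mathcomp Require Import all_classical all_reals all_analysis.

Set Implicit Arguments.
Unset Strict Implicit.
Unset Printing Implicit Defensive.

Import Order.TTheory GRing.Theory Num.Theory.
Import numFieldNormedType.Exports.

Local Open Scope classical_set_scope.
Local Open Scope ring_scope.

(* [R^d] is ['rV[R]_d].  The library norm on ['rV[R]_d] is the sup norm; it
   induces the usual topology, but the sphere needs the Euclidean norm. *)
Definition enorm (R : realType) (d : nat) (x : 'rV[R]_d) : R :=
  Num.sqrt (\sum_(i < d) x 0 i ^+ 2).

Definition usphere (R : realType) (d : nat) : set 'rV[R]_d :=
  [set x | enorm x = 1].

Definition punctured (R : realType) (d : nat) : set 'rV[R]_d :=
  [set y | y != 0].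

Definition partial (R : realType) (d : nat) (i : 'I_d)
    (G : 'rV[R]_d -> R) : 'rV[R]_d -> R :=
  fun y => 'D_(delta_mx 0 i) G y.

(* [U] is meant to be open.  The derivatives ['D_v] are total functions, so the
   existence of each partial derivative is required separately. *)
Fixpoint Ck_on (R : realType) (d : nat) (k : nat) (U : set 'rV[R]_d)
    (G : 'rV[R]_d -> R) : Prop :=
  (forall y, U y -> {for y, continuous G}) /\
  match k with
  | 0%N => True
  | k'.+1 => forall i : 'I_d,
      (forall y, U y -> derivable G y (delta_mx 0 i)) /\
      Ck_on k' U (partial i G)
  end.

Definition laplacian (R : realType) (d : nat)
    (G : 'rV[R]_d -> R) : 'rV[R]_d -> R :=
  fun y => \sum_(i < d) partial i (partial i G) y.

Definition angular (R : realType) (d : nat) (i j : 'I_d)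
    (G : 'rV[R]_d -> R) : 'rV[R]_d -> R :=
  fun y => y 0 i * partial j G y - y 0 j * partial i G y.

(* A function on the sphere is represented by a total function [f] on
   ['rV[R]_d].  For [y != 0] the value [hext f y] depends only on the
   restriction of [f] to [usphere], so the values of [f] off the sphere do not
   affect the partial derivatives of [hext f] at points [y != 0]. *)
Definition hext (R : realType) (d : nat)
    (f : 'rV[R]_d -> R) : 'rV[R]_d -> R :=
  fun y => f ((enorm y)^-1 *: y).

Definition C2_sphere (R : realType) (d : nat) (f : 'rV[R]_d -> R) : Prop :=
  Ck_on 2 (@punctured R d) (hext f).

(* Laplace-Beltrami operator; its values are meaningful on the sphere. *)
Definition Delta0 (R : realType) (d : nat)
    (f : 'rV[R]_d -> R) : 'rV[R]_d -> R :=
  laplacian (hext f).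

(* Angular derivative of a function on the sphere; its values are meaningful on
   the sphere.  In [Dang i j (Dang i j f)] the inner result is first restricted
   to the sphere and then extended again by [hext]. *)
Definition Dang (R : realType) (d : nat) (i j : 'I_d)
    (f : 'rV[R]_d -> R) : 'rV[R]_d -> R :=
  angular i j (hext f).

(* Main.v *)
Require Import Defs.
From HB Require Import structures.
From mathcomp Require Import all_boot all_order all_algebra.
From mathcomp Require Import all_classical all_reals all_analysis.
From mathcomp Require Import ring lra.

Set Implicit Arguments.
Unset Strict Implicit.
Unset Printing Implicit Defensive.

Import Order.TTheory GRing.Theory Num.Theory.
Import numFieldNormedType.Exports.

Local Open Scope classical_set_scope.
Local Open Scope ring_scope.

(** Let [F] be the degree 0 homogeneous extension of [f]. Each [D_{i,j} F] is
    again homogeneous of degree 0, so restricting it to the sphere and extending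
    it back changes nothing, and the double sum is an iterated derivative of [F].
    Expanding gives, with [F_{ij} = d_i d_j F],
    [D_{i,j}^2 F = x_i^2 F_{jj} + x_j^2 F_{ii} - x_i x_j (F_{ij} + F_{ji})
                   - x_i F_i - x_j F_j].
    This is symmetric in [i, j], so the sum over [i < j] is half the sum over all
    pairs, up to the diagonal. Euler's identity [sum_i x_i F_i = 0] kills the first
    order terms, and its derivative in direction [x_j] gives
    [sum_{i,j} x_i x_j F_{ij} = 0]. Only [|x|^2 Laplacian F] survives. *)

(** * Directional derivatives from continuous partial derivatives *)

Lemma is_derive_line (R : realType) (V : normedModType R) (G : V -> R)
    (p v : V) (t d : R) :
  is_derive (p + t *: v) v G d <-> is_derive t 1 (fun s => G (p + s *: v)) d.
Proof.
suff E : (fun h : R => h^-1 *: ((G \o shift (p + t *: v)) (h *: v) -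
                           G (p + t *: v))) =
         (fun h : R => h^-1 *: (((fun s => G (p + s *: v)) \o shift t) (h *: 1) -
                           G (p + t *: v))).
  by split=> -[]; rewrite /derivable /derive ?E -?E => ? <-; split;
    rewrite /derivable /derive ?E -?E.
apply/funext => h /=; do 3 f_equal.
by rewrite [h *: 1]mulr1 scalerDl addrCA.
Qed.

Lemma is_derive_scale_dir (R : realType) (V : normedModType R) (G : V -> R)
    (p v : V) (c d : R) :
  is_derive p v G d -> is_derive p (c *: v) G (c * d).
Proof.
rewrite -[p in is_derive p v G d]addr0 -(scale0r v) is_derive_line => dG.
rewrite -[p]addr0 -(scale0r (c *: v)) is_derive_line.
have -> : (fun s : R => G (p + s *: (c *: v))) =
    (fun s => G (p + s *: v)) \o (fun s => c * s).
  by apply/funext => s /=; rewrite scalerA mulrC.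
rewrite mulrC; apply: is_derive1_comp; first by rewrite mulr0.
rewrite [X in is_derive _ _ _ X](_ : c = c *: 1); last by rewrite [RHS]mulr1.
exact: is_deriveZ.
Qed.

(** By the mean value theorem the quotient equals ['D_v G] at some point between [x + h *: w] and
    [x + h *: (w + v)]; this segment shrinks to [x], where ['D_v G] is continuous. *)
Lemma cvg_increment (R : realType) (V : normedModType R) (G : V -> R)
    (x v w : V) :
  (\forall z \near x, derivable G z v) ->
  {for x, continuous ('D_v G)} ->
  h^-1 * (G (x + h *: (w + v)) - G (x + h *: w)) @[h --> (0:R)^'] --> 'D_v G x.
Proof.
move=> dG cG; apply/cvgrPdist_lt => e e0.
have : \forall z \near x, derivable G z v /\ `|'D_v G x - 'D_v G z| < e.
  near=> z; split; near: z => //.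
  by move/cvgrPdist_lt : cG; exact.
move=> /nbhs_ballP[r /= r0 xr].
(* This bounds the norm of [w + s *: v] for [s] in the unit interval; the added 1 allows division by
   it even when [w] and [v] vanish. *)
have m0 : 0 < `|w| + `|v| + 1 by rewrite ltr_wpDl// addr_ge0.
near=> h.
have hn0 : h != 0 by near: h; exact: nbhs_dnbhs_neq.
have inball (s : R) : 0 <= s <= 1 -> ball x r (x + h *: w + s *: (h *: v)).
  move=> /andP[s0 s1]; rewrite -ball_normE /ball_ /=.
  rewrite -addrA opprD addNKr normrN (le_lt_trans (ler_normD _ _))// !normrZ.
  rewrite (ger0_norm s0) (@le_lt_trans _ _ (`|h| * (`|w| + `|v| + 1)))//.
    rewrite mulrDr mulrDr mulr1 -addrA lerD2l -[leLHS]addr0 lerD//.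
    by rewrite ler_piMl// mulr_ge0.
  by rewrite -ltr_pdivlMr//; near: h; apply: dnbhs0_lt; exact: divr_gt0.
have dphi (s : R) : 0 <= s <= 1 ->
    is_derive s 1 (fun s => G (x + h *: w + s *: (h *: v)))
      (h * 'D_v G (x + h *: w + s *: (h *: v))).
  move=> s01; apply: (is_derive_line G (x + h *: w) (h *: v) s _).1.
  apply: is_derive_scale_dir.
  by have [+ _] := xr _ (inball _ s01) => /derivableP.
have dphi' (s : R) : s \in `]0, 1[ -> is_derive s 1
    (fun s => G (x + h *: w + s *: (h *: v)))
    (h * 'D_v G (x + h *: w + s *: (h *: v))).
  by rewrite in_itv/= => /andP[/ltW s0 /ltW s1]; apply: dphi; rewrite s0.
have [|c c01] := MVT_segment ler01 dphi'.
  apply: derivable_within_continuous => s; rewrite in_itv/= => /dphi ds.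
  exact: (@ex_derive _ _ _ _ _ _ _ ds).
rewrite scale0r addr0 scale1r subr0 mulr1 scalerDr addrA => ->.
rewrite mulKf//; apply: (xr _ (inball _ _)).2.
by rewrite in_itv in c01.
Unshelve. all: by end_near. Qed.

(** Continuity of the partial derivatives makes the derivative linear in the direction. Euler's
    identity uses the radial case [v = x]. *)
Lemma is_derive_C1 (R : realType) (d : nat) (G : 'rV[R]_d -> R)
    (x v : 'rV[R]_d) :
  (forall i, \forall z \near x, derivable G z (delta_mx 0 i)) ->
  (forall i, {for x, continuous (partial i G)}) ->
  is_derive x v G (\sum_(i < d) v 0 i * partial i G x).
Proof.
move=> dG cG.
(* The base point [x + h *: w] moves with [h], which makes [P] additive in
   [(u, l)]: increments along coordinate vectors telescope. *)
pose P (u : 'rV[R]_d) (l : R) := forall w,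
  h^-1 * (G (x + h *: (w + u)) - G (x + h *: w)) @[h --> (0:R)^'] --> l.
have H : P v (\sum_(i < d) v 0 i * partial i G x).
  rewrite [X in P X _]row_sum_delta; apply: (big_ind2 P).
  - move=> w; under eq_fun do rewrite addr0 subrr mulr0; exact: cvg_cst.
  - move=> u1 l1 u2 l2 H1 H2 w; rewrite [l1 + _]addrC.
    have -> : (fun h => h^-1 * (G (x + h *: (w + (u1 + u2))) - G (x + h *: w))) =
      (fun h => h^-1 * (G (x + h *: (w + u1 + u2)) - G (x + h *: (w + u1))) +
        h^-1 * (G (x + h *: (w + u1)) - G (x + h *: w))).
      by apply/funext => h; rewrite [w + _]addrA -mulrDr subrKA.
    by apply: cvgD; [exact: H2|exact: H1].
  - move=> i _ w.
    have E z : derivable G z (delta_mx 0 i) ->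
        is_derive z (v 0 i *: delta_mx 0 i) G (v 0 i * partial i G z).
      by move=> /derivableP; exact: is_derive_scale_dir.
    have Ex := E _ (nbhs_singleton (dG i)).
    rewrite -(@derive_val _ _ _ _ _ _ _ Ex); apply: cvg_increment.
      by near=> z; apply: ex_derive; apply: E; near: z; exact: dG.
    (* Near [x] this derivative coincides with [v 0 i * partial i G], from which it inherits
       continuity. *)
    suff : 'D_(v 0 i *: delta_mx 0 i) G z @[z --> x] -->
        'D_(v 0 i *: delta_mx 0 i) G x by [].
    rewrite (@derive_val _ _ _ _ _ _ _ Ex).
    apply: cvg_trans (cvgMr (a := v 0 i) (cG i)).
    apply: (@near_eq_cvg _ _ (nbhs x) _ (fun z => v 0 i * partial i G z)
      ('D_(v 0 i *: delta_mx 0 i) G)).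
    by apply: filterS (dG i) => z /E[_ ->].
have E : (fun h : R => h^-1 *: ((G \o shift x) (h *: v) - G x)) =
         (fun h => h^-1 * (G (x + h *: (0 + v)) - G (x + h *: 0))).
  by apply/funext => h /=; rewrite add0r scaler0 addr0 [x + _]addrC.
split; rewrite /derivable /derive E.
  by apply/cvg_ex; eexists; exact: (H 0).
apply/cvg_lim; [by []|exact: (H 0)].
Unshelve. all: by end_near. Qed.

(** * Homogeneous extensions and Euler's identity *)

Section sphere.
Variables (R : realType) (d : nat).
Implicit Types (f : 'rV[R]_d -> R) (x y : 'rV[R]_d) (c : R).

Lemma enorm_pscale c y : 0 < c -> enorm (c *: y) = c * enorm y.
Proof.
move=> c0; rewrite /enorm; under eq_bigr do rewrite mxE exprMn.
by rewrite -mulr_sumr sqrtrM ?sqr_ge0// sqrtr_sqr gtr0_norm.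
Qed.

Lemma enorm_gt0 y : y != 0 -> 0 < enorm y.
Proof.
move=> y0; rewrite sqrtr_gt0 lt_def sumr_ge0 ?andbT; last first.
  by move=> i _; exact: sqr_ge0.
apply: contra_neq y0 => s0; apply/rowP => i; rewrite mxE.
have /psumr_eq0P : \sum_(i < d) y 0 i ^+ 2 = 0 by [].
by move=> /(_ (fun i _ => sqr_ge0 (y 0 i)) i isT)/eqP; rewrite sqrf_eq0 => /eqP.
Qed.

Lemma usphere_neq0 x : usphere x -> x != 0.
Proof.
apply: contraPneq => ->; rewrite /usphere /enorm /=.
under eq_bigr do rewrite mxE expr0n.
by rewrite big1// sqrtr0 => /eqP; rewrite eq_sym oner_eq0.
Qed.

Lemma hext_pscale f c y : 0 < c -> hext f (c *: y) = hext f y.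
Proof.
move=> c0; rewrite /hext enorm_pscale// scalerA invfM mulrAC mulVf ?gt_eqF//.
by rewrite mul1r.
Qed.

(** Differentiating a function of degree 0 lowers the degree to -1: a step [s] from [c *: y] is, up
    to the factor [c], a step [c^-1 * s] from [y]. *)
Lemma partial_hext_pscale f i c y : 0 < c ->
  derivable (hext f) y (delta_mx 0 i) ->
  partial i (hext f) (c *: y) = c^-1 * partial i (hext f) y.
Proof.
move=> c0 /derivableP df; apply: derive_val.
rewrite -[c *: y]addr0 -(scale0r (delta_mx 0 i)) is_derive_line.
have -> : (fun s : R => hext f (c *: y + s *: delta_mx 0 i)) =
    (fun s => hext f (y + s *: (c^-1 *: delta_mx 0 i))).
  apply/funext => s; rewrite -[RHS](hext_pscale f _ c0) scalerDr !scalerA.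
  by rewrite mulrAC divff ?gt_eqF// mul1r.
by rewrite -is_derive_line scale0r addr0; exact: is_derive_scale_dir.
Qed.

(** The coordinate factors have degree 1 and the partial derivatives degree -1, so the products have
    degree 0. *)
Lemma hext_angular f i j :
  (forall k y, y != 0 -> derivable (hext f) y (delta_mx 0 k)) ->
  hext (angular i j (hext f)) = angular i j (hext f).
Proof.
move=> df; apply/funext => y; rewrite [LHS]/hext.
(* At the origin normalization returns 0 itself, so both sides are the same value. *)
have [->|y0] := eqVneq y 0; first by rewrite scaler0.
have n0 := enorm_gt0 y0; rewrite /angular !mxE.
rewrite !partial_hext_pscale ?invr_gt0//; try exact: df.
by rewrite invrK; field; rewrite gt_eqF.
Qed.

Lemma nbhs_neq0 x : x != 0 -> \forall z \near x, z != 0.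
Proof. by move=> x0; exact: (@cvgr_neq0 _ _ _ (nbhs x) _ id x cvg_id). Qed.

(** The sum is the derivative of [hext f] in the radial direction, along which [hext f] is
    constant. *)
Lemma euler_hext f x : C2_sphere f -> x != 0 ->
  \sum_(i < d) x 0 i * partial i (hext f) x = 0.
Proof.
move=> [cf df] x0.
have D : is_derive x x (hext f) (\sum_(i < d) x 0 i * partial i (hext f) x).
  apply: is_derive_C1 => i; last by have [_ [+ _]] := df i; exact.
  by near=> z; have [+ _] := df i; apply; near: z; exact: nbhs_neq0.
rewrite -(@derive_val _ _ _ _ _ _ _ D).
apply: derive_val; rewrite -[x in is_derive x]addr0 -(scale0r x) is_derive_line.
apply: (near_eq_is_derive _ (is_derive_cst (hext f x) (0 : R) 1)).
(* The point [x + s *: x] is [(1 + s) *: x], a positive multiple of [x] once [s > -1]. *)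
near=> s => /=; rewrite -[X in _ = hext f (X + _)]scale1r -scalerDl.
rewrite hext_pscale// -ltrBlDl sub0r.
near: s; apply: lt_nbhsr; by rewrite oppr_lt0.
Unshelve. all: by end_near. Qed.

Lemma is_derive_coord (i : 'I_d) x v :
  is_derive x v (fun y : 'rV[R]_d => y 0 i) (v 0 i).
Proof.
rewrite -[x in is_derive x]addr0 -(scale0r v) is_derive_line.
have -> : (fun s : R => (x + s *: v) 0 i) =
    (cst (x 0 i) + (fun s => v 0 i * s)).
  by apply/funext => s; rewrite !mxE mulrC.
rewrite [X in is_derive _ _ _ X](_ : _ = 0 + v 0 i *: 1).
  apply: is_deriveD; exact: is_deriveZ.
by rewrite add0r [RHS]mulr1.
Qed.

(** Euler's identity holds on a neighbourhood of [x], so it may be differentiated; the product rule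
    contributes the extra term [partial j (hext f) x]. *)
Lemma euler_partial_hext f x j : C2_sphere f -> x != 0 ->
  \sum_(i < d) x 0 i * partial j (partial i (hext f)) x =
  - partial j (hext f) x.
Proof.
move=> hf x0; apply/eqP; rewrite -addr_eq0; apply/eqP.
have D : is_derive x (delta_mx 0 j)
    (\sum_(i < d) (fun y : 'rV[R]_d => y 0 i) * partial i (hext f))
    (\sum_(i < d) (x 0 i *: partial j (partial i (hext f)) x +
       partial i (hext f) x *: (delta_mx 0 j : 'rV[R]_d) 0 i)).
  apply: is_derive_sum => i; apply: is_deriveM; first exact: is_derive_coord.
  by apply/derivableP; have [_ [_ /(_ j)[+ _]]] := hf.2 i; exact.
transitivity ('D_(delta_mx 0 j) (cst 0 : 'rV[R]_d -> R) x); last exact: derive_cst.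
rewrite (near_eq_derive (g :=
  \sum_(i < d) (fun y : 'rV[R]_d => y 0 i) * partial i (hext f))); last first.
  have := nbhs_neq0 x0; apply: filterS => z z0.
  by rewrite -(euler_hext hf z0) fct_sumE.
rewrite (@derive_val _ _ _ _ _ _ _ D) big_split/=; congr (_ + _).
rewrite (bigD1 j)//= big1 => [|i /negbTE ij]; rewrite !mxE ?eqxx ?ij/=.
  by rewrite addr0 [RHS]mulr1.
exact: mulr0.
Qed.

Lemma partial_angular f i j k x : C2_sphere f -> x != 0 ->
  partial k (angular i j (hext f)) x =
    x 0 i * partial k (partial j (hext f)) x +
      (k == i)%:R * partial j (hext f) x -
    (x 0 j * partial k (partial i (hext f)) x +
      (k == j)%:R * partial i (hext f) x).
Proof.
move=> hf x0; apply: derive_val.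
have D a b : is_derive x (delta_mx 0 k)
    ((fun y : 'rV[R]_d => y 0 a) * partial b (hext f))
    (x 0 a * partial k (partial b (hext f)) x +
      (k == a)%:R * partial b (hext f) x).
  rewrite [X in is_derive _ _ _ X](_ : _ =
    x 0 a *: partial k (partial b (hext f)) x +
    partial b (hext f) x *: (delta_mx 0 k : 'rV[R]_d) 0 a).
    apply: is_deriveM; first exact: is_derive_coord.
    by apply/derivableP; have [_ [_ /(_ k)[+ _]]] := hf.2 b; exact.
  by rewrite !mxE eqxx/= eq_sym; congr (_ + _); rewrite mulrC.
exact: is_deriveB (D i j) (D j i).
Qed.

Lemma Dang_sqr f i j x : C2_sphere f -> x != 0 -> i != j ->
  let H a b := partial a (partial b (hext f)) x in
  Dang i j (Dang i j f) x =
    x 0 i ^+ 2 * H j j + x 0 j ^+ 2 * H i i - x 0 i * x 0 j * (H i j + H j i)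
    - x 0 i * partial i (hext f) x - x 0 j * partial j (hext f) x.
Proof.
move=> hf x0 ij H; rewrite /Dang hext_angular; last first.
  by move=> k y y0; have [+ _] := hf.2 k; exact.
rewrite {1}/angular !partial_angular// !eqxx [j == i]eq_sym (negbTE ij) {}/H.
move: (partial i (partial i _) x) (partial i (partial j _) x) => Hii Hij.
move: (partial j (partial i _) x) (partial j (partial j _) x) => Hji Hjj.
move: (partial i _ x) (partial j _ x) => Pi Pj.
rewrite !mulr1n !mulr0n; ring.
Qed.

End sphere.

(** * Summation over pairs of indices *)

Lemma sum_symmetric (V : zmodType) (d : nat) (S : 'I_d -> 'I_d -> V) :
  (forall i j, S i j = S j i) ->
  \sum_i \sum_j S i j =
    (\sum_(i < d) \sum_(j < d | (i < j)%N) S i j) *+ 2 + \sum_i S i i.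
Proof.
move=> symS.
(* Each row is split at the diagonal; exchanging the two sums then turns the lower triangle into the
   upper one. *)
have -> : \sum_i \sum_j S i j = \sum_(i < d) (\sum_(j < d | (i < j)%N) S i j +
    (S i i + \sum_(j < d | (j < i)%N) S i j)).
  apply: eq_bigr => i _; rewrite (bigID (fun j : 'I_d => (i < j)%N))/=.
  congr (_ + _); rewrite (bigD1 i) ?ltnn//=; congr (_ + _).
  by apply: eq_bigl => j; rewrite -leqNgt andbC -ltn_neqAle.
rewrite !big_split/= addrCA [RHS]addrC; congr (_ + _); rewrite mulr2n.
congr (_ + _); rewrite (exchange_big_dep xpredT)//=.
by apply: eq_bigr => i _; apply: eq_bigr => j _; exact: symS.
Qed.

Theorem theorem8p2 (R : realType) (d : nat) (hd : (2 <= d)%N)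
    (f : 'rV[R]_d -> R) (hf : C2_sphere f)
    (xi : 'rV[R]_d) (hxi : usphere xi) :
  Delta0 f xi =
    \sum_(i < d) \sum_(j < d | (i < j)%N) Dang i j (Dang i j f) xi.
Proof.
have xi0 := usphere_neq0 hxi.
have nxi : \sum_i xi 0 i ^+ 2 = 1.
  rewrite -[LHS]sqr_sqrtr; last by apply: sumr_ge0 => i _; exact: sqr_ge0.
  by rewrite -/(enorm xi) hxi expr1n.
pose P i := partial i (hext f) xi.
pose H i j := partial i (partial j (hext f)) xi.
pose S i j := xi 0 i ^+ 2 * H j j + xi 0 j ^+ 2 * H i i
  - xi 0 i * xi 0 j * (H i j + H j i) - xi 0 i * P i - xi 0 j * P j.
have euler : \sum_i xi 0 i * P i = 0 by exact: euler_hext.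
have euler2 : \sum_i \sum_j xi 0 i * xi 0 j * H i j = 0.
  transitivity (- \sum_i xi 0 i * P i); last by rewrite euler oppr0.
  rewrite -sumrN; apply: eq_bigr => i _.
  under eq_bigr do rewrite -mulrA.
  by rewrite -mulr_sumr euler_partial_hext// mulrN.
have -> : \sum_(i < d) \sum_(j < d | (i < j)%N) Dang i j (Dang i j f) xi =
    \sum_(i < d) \sum_(j < d | (i < j)%N) S i j.
  apply: eq_bigr => i _; apply: eq_bigr => j ij; rewrite Dang_sqr//.
  by apply: contraTneq ij => ->; rewrite ltnn.
have -> : Delta0 f xi = \sum_j H j j by [].
(* What remains is algebra in the numbers [P i] and [H i j], governed by [nxi], [euler] and
   [euler2]. *)
clearbody P H.
have symS i j : S i j = S j i by rewrite /S; ring.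
have := sum_symmetric symS.
(* On the diagonal the second order terms cancel, leaving [- 2 * (xi 0 i * P i)]. *)
have -> : \sum_i S i i = 0.
  transitivity (\sum_i (- 2) * (xi 0 i * P i)).
    by apply: eq_bigr => i _; rewrite /S; ring.
  by rewrite -mulr_sumr euler mulr0.
(* Each of the two sums with squared coordinates equals the Laplacian because [xi] has norm 1; all
   other sums vanish. *)
have -> : \sum_i \sum_j S i j = (\sum_j H j j) *+ 2.
  have E1 : \sum_i \sum_j xi 0 i ^+ 2 * H j j = \sum_j H j j.
    by under eq_bigr do rewrite -mulr_sumr; rewrite -mulr_suml nxi mul1r.
  have E2 : \sum_i \sum_(j < d) xi 0 i * P i = 0.
    under eq_bigr do rewrite sumr_const.
    by rewrite sumrMnl euler mul0rn.
  transitivity (\sum_i \sum_j xi 0 i ^+ 2 * H j j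
      + \sum_i \sum_j xi 0 j ^+ 2 * H i i
      - (\sum_i \sum_j xi 0 i * xi 0 j * H i j
         + \sum_i \sum_j xi 0 j * xi 0 i * H j i)
      - \sum_i \sum_(j < d) xi 0 i * P i - \sum_(i < d) \sum_j xi 0 j * P j).
    rewrite -!big_split -!sumrB/=; apply: eq_bigr => i _.
    rewrite -!big_split -!sumrB/=; apply: eq_bigr => j _.
    by rewrite /S; ring.
  (* Swapping the summation order reduces the mirrored sums to those of [E1], [euler2] and [E2]. *)
  rewrite [X in _ + X - _ - _ - _]exchange_big [X in _ - (_ + X) - _ - _]exchange_big.
  rewrite [X in _ - X]exchange_big/= E1 E2 euler2.
  by rewrite addr0 !subr0 mulr2n.
by rewrite addr0 => E; lra.
Qed.
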